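(* Let $n,q,r\ge 1$ be integers with $\frac{q+1}{2}\le r\le \frac{qn}{2}$, and let $\mathcal{F}\subseteq \{0,1,\dots,q\}^n$ be an $r$-rank uniform $(q+1)$-sum intersecting family. Then \[ |\mathcal{F}|\le \begin{cases} \sum_{j=\frac{q+1}{2}}^q|Q(n-1,r-j)| & \text{if } q+1 \text{ is even},\\[4pt] 1+\sum_{j=\lceil\frac{q+1}{2}\rceil}^q\ \sum_{i=1}^{\lfloor \frac{2(r-1)}{q}\rfloor}\left|Q\!\left(n-i,\,r-j-\tfrac{(i-1)q}{2}\right)\right| & \text{if } q+1 \text{ is odd}, \end{cases} \] and these bounds are best possible.
   Context: The rank of $\mathbf{x}\in\{0,1,\dots,q\}^n$ is $r(\mathbf{x})=\sum_{i=1}^n x_i$; a family is $r$-rank uniform if all its members have rank $r$. $Q(m,\ell)$ denotes the set of all vectors in $\{0,1,\dots,q\}^m$ of rank $\ell$ (empty if $\ell<0$). Two vectors $\mathbf{x},\mathbf{y}\in\{0,1,\dots,q\}^n$ are $(q+1)$-sum intersecting if there is a coordinate $i$ with $x_i+y_i\ge q+1$; a family is $(q+1)$-sum intersecting if any two distinct members are $(q+1)$-sum intersecting. *)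

(* Defs.v *)
From mathcomp Require Import all_boot all_order all_algebra.

Set Implicit Arguments.
Unset Strict Implicit.
Unset Printing Implicit Defensive.

Definition qvec (q n : nat) := {ffun 'I_n -> 'I_q.+1}.

Definition rank (q n : nat) (x : qvec q n) : nat := \sum_(i < n) (x i : nat).

Definition rank_uniform (q n r : nat) (F : {set qvec q n}) : Prop :=
  forall x, x \in F -> rank x = r.

Definition sum_intersecting2 (q n : nat) (x y : qvec q n) : Prop :=
  exists i : 'I_n, q.+1 <= x i + y i.

Definition sum_intersecting (q n : nat) (F : {set qvec q n}) : Prop :=
  forall x y, x \in F -> y \in F -> x <> y -> sum_intersecting2 x y.

(* The rank l is an integer, so that Q q m l is empty for negative l. *)
Definition Q (q m : nat) (l : int) : {set qvec q m} :=
  [set x : qvec q m | Posz (rank x) == l].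

Definition bound_succq_even (n q r : nat) : nat :=
  \sum_(q.+1 %/ 2 <= j < q.+1) #|Q q (n - 1) (r%:Z - j%:Z)%R|.

(* Here q is even, so (i - 1) * q %/ 2 is exact, and uphalf is the ceiling of
   the half. For the parameters of interest i < n, so n - i does not truncate. *)
Definition bound_succq_odd (n q r : nat) : nat :=
  1 + \sum_(uphalf q.+1 <= j < q.+1)
        \sum_(1 <= i < ((2 * (r - 1)) %/ q).+1)
          #|Q q (n - i) (r%:Z - j%:Z - (((i - 1) * q) %/ 2)%N%:Z)%R|.

Definition bound (n q r : nat) : nat :=
  if odd q.+1 then bound_succq_odd n q r else bound_succq_even n q r.

(* Main.v *)
Require Import Defs.
From mathcomp Require Import all_boot all_order all_algebra.
From mathcomp Require Import zify.

(* Say that x and y meet when x_i + y_i > q for some i.  Fix two coordinates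
   i < j.  The members of F with given other coordinates and given x_i + x_j
   form a fibre, and replacing each fibre by the final segment (in x_i) of the
   same size preserves F being intersecting, so we may assume that F is closed
   under x |-> x + e_i - e_j for i < j.  At most one member of F fails to meet
   itself, none if q is odd; the others form a strongly intersecting closed
   family.

   The slices of such a family by the last coordinate pairwise meet.  A slice
   of rank at most q n / 2 is bounded by induction, and the remaining slices are
   paired with slices of complementary rank, where x and the complement of x
   cannot both occur.  The family of all x whose first entry different from q/2
   is larger than q/2 satisfies all these inequalities with at least equality,
   hence it is the largest one; counting it by the position and the value of
   that entry gives the bound, and for even q one more vector can be added. *)

Set Implicit Arguments.
Unset Strict Implicit.
Unset Printing Implicit Defensive.

(** * Meeting pairs and sizes of separated sets of values *)

Definition meets (q n : nat) (x y : qvec q n) : bool :=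
  [exists i, q < x i + y i].

Lemma meetsC q n (x y : qvec q n) : meets x y = meets y x.
Proof. by apply: eq_existsb => i; rewrite addnC. Qed.

Lemma sum_intersecting_meets q n (F : {set qvec q n}) :
  sum_intersecting F <->
  (forall x y : qvec q n, x \in F -> y \in F -> x != y -> meets x y).
Proof.
split=> FI x y xF yF.
  by move/eqP/(FI _ _ xF yF)=> [i xyi]; apply/existsP; exists i.
by move/eqP/(FI _ _ xF yF)/existsP=> [i xyi]; exists i.
Qed.

Lemma card_ord_interval_le N (X : {set 'I_N}) lo hi :
  (forall x : 'I_N, x \in X -> lo <= x < hi) -> #|X| <= hi - lo.
Proof.
move=> Xb; rewrite cardE -(size_map val) -(size_iota lo (hi - lo)).
apply: uniq_leq_size; first by rewrite map_inj_uniq ?enum_uniq //; apply: val_inj.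
move=> k /mapP[x]; rewrite mem_enum => /Xb xb ->; rewrite mem_iota /=; lia.
Qed.

(* After the reflection b |-> q - b the hypothesis says that Y has no point in
   a window of 2q - s - s' + 1 values starting at a point of X.  Either some
   adjacent pair x < y leaves such a window empty, or Y lies below X. *)
Lemma separated_size q s s' (X Y : {set 'I_q.+1}) :
  X != set0 -> Y != set0 -> s + s' <= 2 * q ->
  (forall a : 'I_q.+1, a \in X -> a <= s <= a + q) ->
  (forall b : 'I_q.+1, b \in Y -> b <= s' <= b + q) ->
  (forall a b : 'I_q.+1, a \in X -> b \in Y -> q < a + b \/ a + b + q < s + s') ->
  #|X| + #|Y| + q <= minn q s + minn q s' + 1.
Proof.
move=> X0 Y0 ss Xb Yb sep.
set Z := [set rev_ord b | b in Y].
have ZY b : (b \in Z) = (rev_ord b \in Y).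
  by rewrite -{1}(rev_ordK b) mem_imset //; apply: rev_ord_inj.
have cZ : #|Z| = #|Y| by rewrite card_imset //; apply: rev_ord_inj.
have Zb (b : 'I_q.+1) : b \in Z -> q <= b + s' <= q + q.
  rewrite ZY => /Yb /=; have := ltn_ord b; lia.
have sepZ (a b : 'I_q.+1) : a \in X -> b \in Z -> b < a \/ a + q + q < b + s + s'.
  move=> aX; rewrite ZY => /(sep _ _ aX) /=; have := ltn_ord b; lia.
have cU : #|X| + #|Y| = #|X :|: Z|.
  rewrite cardsU -cZ (_ : X :&: Z = set0) ?cards0 ?subn0 //.
  apply/setP=> a; rewrite !inE; apply/negP=> /andP[aX aZ].
  have := sepZ _ _ aX aZ; lia.
case: (boolP [exists p : 'I_q.+1 * 'I_q.+1, [&& p.1 \in X, p.2 \in Z & p.1 < p.2]]).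
  case/existsP=> p0 p0P.
  (* A closest pair [x < y] has no point of [X :|: Z] strictly between, and [sepZ] forces y - x > 2q
     - s - s'. *)
  case: (@arg_minnP _ p0 (fun p : 'I_q.+1 * 'I_q.+1 =>
    [&& p.1 \in X, p.2 \in Z & p.1 < p.2]) (fun p => p.2 - p.1) p0P).
  case=> x y /= /and3P[xX yZ xy] mn.
  have adj (z : 'I_q.+1) : z \in X :|: Z -> z <= x \/ y <= z.
    rewrite inE => /orP[zX|zZ]; [have := mn (z, y) | have := mn (x, z)];
      rewrite /= ?zX ?zZ ?xX ?yZ /=; lia.
  have sxy := sepZ _ _ xX yZ.
  have lo (z : 'I_q.+1) : z \in X :|: Z -> (s - q <= z \/ q - s' <= z) /\
      (z <= minn q s \/ z <= minn q (q + q - s')).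
    rewrite inE; have := ltn_ord z => zq /orP[/Xb|/Zb]; lia.
  have c1 : #|[set z in X :|: Z | z <= x]| <= x.+1 - minn (s - q) (q - s').
    apply: card_ord_interval_le => z; rewrite inE => /andP[/lo]; lia.
  have c2 : #|[set z in X :|: Z | y <= z]| <=
      (maxn (minn q s) (minn q (q + q - s'))).+1 - y.
    apply: card_ord_interval_le => z; rewrite inE => /andP[/lo]; lia.
  have c3 : #|X :|: Z| <= #|[set z in X :|: Z | z <= x]| + #|[set z in X :|: Z | y <= z]|.
    apply: leq_trans (leq_card_setU _ _); apply/subset_leq_card/subsetP=> z zU.
    by rewrite in_setU; case: (adj z zU) => h; apply/orP; [left|right];
      rewrite in_set zU.
  have h1 := Xb _ xX; have h2 := Zb _ yZ; have h3 := ltn_ord y; have h4 := ltn_ord x.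
  have {}c3 := leq_trans c3 (leq_add c1 c2); rewrite cU.
  move: {mn sep sepZ lo adj} c3 h1 h2 h3 h4 sxy xy ss; rewrite {c1 c2}.
  move: #|X :|: Z| (nat_of_ord x) (nat_of_ord y) => U a b.
  clear; lia.
move/existsPn=> nlt.
have YX (x y : 'I_q.+1) : x \in X -> y \in Z -> y <= x.
  by move=> xX yZ; have := nlt (x, y); rewrite /= xX yZ /=; lia.
have [x0 x0X] := set0Pn _ X0; have [y0 y0Y] := set0Pn _ Y0.
have y0Z : rev_ord y0 \in Z by rewrite ZY rev_ordK.
(* All of [Z] lies weakly below all of [X], so the lower bound of [Z] and the upper bound of [X]
   hold on the whole union. *)
have c1 : #|X :|: Z| <= (minn q s).+1 - (q - s').
  apply: card_ord_interval_le => z; rewrite inE; have := ltn_ord z => zq /orP[zX|zZ].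
    have := Xb _ zX; have := Zb _ y0Z; have := YX _ _ zX y0Z; lia.
  have := Xb _ x0X; have := Zb _ zZ; have := YX _ _ x0X zZ; lia.
have := Xb _ x0X; have := Zb _ y0Z; have := YX _ _ x0X y0Z; have := ltn_ord x0; lia.
Qed.

(** * Compression in two coordinates *)

Section Compression.

Variables (q n : nat) (i j : 'I_n).
Hypothesis ij : i != j.

Implicit Types (x y : qvec q n) (a b : 'I_q.+1).

(** The entry at [j] is forced by keeping [x i + x j]. It is legal exactly when [admissible x a]
    holds; otherwise a default value appears there. *)
Definition redistribute x a : qvec q n :=
  [ffun k => if k == i then a
             else if k == j then inord (x i + x j - a) else x k].

Definition admissible x a : bool := (a <= x i + x j) && (x i + x j <= a + q).

Lemma redistribute_i x a : redistribute x a i = a.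
Proof. by rewrite ffunE eqxx. Qed.

Lemma redistribute_j x a :
  admissible x a -> redistribute x a j = x i + x j - a :> nat.
Proof.
case/andP=> h1 h2.
by rewrite ffunE eq_sym (negbTE ij) eqxx inordK //; lia.
Qed.

Lemma redistribute_out x a k : k != i -> k != j -> redistribute x a k = x k.
Proof. by move=> /negbTE ki /negbTE kj; rewrite ffunE ki kj. Qed.

Lemma redistribute_sum x a : admissible x a ->
  redistribute x a i + redistribute x a j = x i + x j.
Proof.
by move=> ad; rewrite redistribute_j // redistribute_i; case/andP: ad; lia.
Qed.

Lemma admissible_redistribute x a b :
  admissible x a -> admissible (redistribute x a) b = admissible x b.
Proof. by move=> ad; rewrite /admissible redistribute_sum. Qed.

Lemma redistribute2 x a b : admissible x a ->
  redistribute (redistribute x a) b = redistribute x b.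
Proof.
move=> ad; apply/ffunP=> k; rewrite !ffunE eqxx.
case: (altP (k =P i)) => // ki; case: (altP (k =P j)) => // kj.
by have := redistribute_sum ad; rewrite !ffunE eqxx => ->.
Qed.

Lemma admissible_id x : admissible x (x i).
Proof. by rewrite /admissible; have := ltn_ord (x j); lia. Qed.

Lemma redistribute_id x : redistribute x (x i) = x.
Proof.
apply/ffunP=> k; rewrite ffunE; case: (altP (k =P i)) => [->//|ki].
by case: (altP (k =P j)) => [->|//]; rewrite addKn inord_val.
Qed.

Lemma rank_redistribute x a : admissible x a -> rank (redistribute x a) = rank x.
Proof.
move=> ad; rewrite /rank (bigD1 i) //= (bigD1 j) 1?eq_sym //= addnA.
rewrite redistribute_sum // [RHS](bigD1 i) //= [in RHS](bigD1 j) 1?eq_sym //= addnA.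
by congr (_ + _); apply: eq_bigr => k /andP[ki kj]; rewrite redistribute_out.
Qed.

Variable F : {set qvec q n}.

(** A fibre is recorded by its values at [i], since the entry at [j] follows from the sum. *)
Definition fiber x : {set 'I_q.+1} :=
  [set a | admissible x a && (redistribute x a \in F)].

Lemma fiber_redistribute x a :
  admissible x a -> fiber (redistribute x a) = fiber x.
Proof.
by move=> ad; apply/setP=> b; rewrite !inE admissible_redistribute // redistribute2.
Qed.

Lemma fiber_id x : x \in F -> x i \in fiber x.
Proof. by rewrite inE admissible_id redistribute_id. Qed.

Definition above x := #|[set b in fiber x | x i < b]|.

(** The largest admissible value at [i] is min(q, x_i + x_j); a member with k fibre values above its
    own goes k places below that top. *)
Definition compress_pos x : 'I_q.+1 := inord (minn q (x i + x j) - above x).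

(* Each fibre of F is replaced by a final segment of the same size. *)
Definition compress1 x : qvec q n := redistribute x (compress_pos x).

Definition compress : {set qvec q n} := [set compress1 x | x in F].

Lemma above_le x : x i + above x <= minn q (x i + x j).
Proof.
have : above x <= (minn q (x i + x j)).+1 - (x i).+1.
  apply: card_ord_interval_le => b; rewrite !inE => /andP[/andP[/andP[h1 h2] _] h3].
  have := ltn_ord b; lia.
have := ltn_ord (x i); lia.
Qed.

Lemma above_lt_fiber x : x \in F -> above x < #|fiber x|.
Proof.
move=> xF; apply: proper_card; apply/properP; split.
  by apply/subsetP=> b; rewrite inE => /andP[].
by exists (x i); rewrite ?fiber_id // inE ltnn andbF.
Qed.

Lemma compress_posE x : compress_pos x = minn q (x i + x j) - above x :> nat.
Proof. by rewrite /compress_pos inordK //; lia. Qed.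

Lemma compress_pos_ge x : x i <= compress_pos x.
Proof. by rewrite compress_posE; have := above_le x; lia. Qed.

Lemma admissible_compress x : admissible x (compress_pos x).
Proof.
have := compress_pos_ge x; have := ltn_ord (x j); have := above_le x.
rewrite /admissible compress_posE; lia.
Qed.

Lemma compress1_i x : compress1 x i = compress_pos x.
Proof. exact: redistribute_i. Qed.

Lemma compress1_sum x : compress1 x i + compress1 x j = x i + x j.
Proof. by apply: redistribute_sum; apply: admissible_compress. Qed.

Lemma same_fiber x y : compress1 x = compress1 y ->
  fiber x = fiber y /\ y = redistribute x (y i).
Proof.
move=> e; split.
  by rewrite -(fiber_redistribute (admissible_compress x)) -/(compress1 x) e
             fiber_redistribute // admissible_compress.
rewrite -(redistribute2 _ (admissible_compress x)) -/(compress1 x) e.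
by rewrite redistribute2 ?redistribute_id // admissible_compress.
Qed.

Lemma above_anti x y : fiber x = fiber y -> y \in F -> x i < y i -> above y < above x.
Proof.
move=> e yF xy; apply: proper_card; apply/properP; split.
  apply/subsetP=> b; rewrite !in_set => /andP[/andP[b1 b2] h].
  by move: (b1) (b2); have : b \in fiber x by [rewrite e inE b1 b2]; rewrite inE;
    move=> /andP[-> ->] _ _ /=; apply: leq_trans h; apply: leqW.
by exists (y i); rewrite in_set ?ltnn ?andbF // e fiber_id.
Qed.

(** Equal images come from one fibre, where [above] strictly decreases in the value at [i]. *)
Lemma compress1_inj : {in F &, injective compress1}.
Proof.
move=> /= x y xF yF e; have [ef ey] := same_fiber e.
have sxy : x i + x j = y i + y j by rewrite -compress1_sum e compress1_sum.
have pxy : minn q (x i + x j) - above x = minn q (x i + x j) - above y.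
  by rewrite -compress_posE -compress1_i e compress1_i compress_posE sxy.
have [ax ay] : above x <= minn q (x i + x j) /\ above y <= minn q (x i + x j).
  by split; [have := above_le x | have := above_le y; rewrite sxy];
    apply: leq_trans; apply: leq_addl.
move: (minn _ _) pxy ax ay => A pxy ax ay.
case: (ltngtP (x i) (y i)) => h.
- by have := above_anti ef yF h; lia.
- by have := above_anti (esym ef) xF h; lia.
by rewrite ey -(val_inj h) redistribute_id.
Qed.

Lemma card_compress : #|compress| = #|F|.
Proof. exact: card_in_imset compress1_inj. Qed.

Lemma compressP y : y \in compress -> exists2 x : qvec q n, x \in F & y = compress1 x.
Proof. by case/imsetP=> x xF ->; exists x. Qed.

(** If two images did not meet, distinct redistributions of [x] and [y] lying in [F] could meet only
    at [i] or [j]. Then [separated_size] makes the fibres so small that the final segments force the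
    images to meet at [i]. *)
Lemma compress_intersecting :
  sum_intersecting F -> sum_intersecting compress.
Proof.
move=> /sum_intersecting_meets FI; apply/sum_intersecting_meets.
move=> _ _ /compressP[x xF ->] /compressP[y yF ->] nxy; apply/contraT => /existsPn nm.
have out k : k != i -> k != j -> x k + y k <= q.
  move=> ki kj; have := nm k; rewrite !redistribute_out //; lia.
have := nm i; have := nm j; rewrite -!leqNgt => nmj nmi.
have sx := compress1_sum x; have sy := compress1_sum y.
have ss : (x i + x j) + (y i + y j) <= 2 * q by move: sx sy nmi nmj; clear; lia.
have sep a b : a \in fiber x -> b \in fiber y ->
    redistribute x a != redistribute y b ->
    q < a + b \/ a + b + q < (x i + x j) + (y i + y j).
  rewrite !inE => /andP[xa aF] /andP[yb bF] /(FI _ _ aF bF)/existsP[k].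
  case: (altP (k =P i)) => [->|ki]; first by rewrite !redistribute_i; left.
  case: (altP (k =P j)) => [->|kj].
    rewrite !redistribute_j //; case/andP: xa; case/andP: yb; clear; lia.
  by rewrite !redistribute_out // ltnNge out.
have fb z a : a \in fiber z -> a <= z i + z j <= a + q.
  by rewrite inE => /andP[].
have fx0 : fiber x != set0 by apply/set0Pn; exists (x i); apply: fiber_id.
have fy0 : fiber y != set0 by apply/set0Pn; exists (y i); apply: fiber_id.
have ax := above_lt_fiber xF; have ay := above_lt_fiber yF.
have lx := above_le x; have ly := above_le y.
have px := compress_posE x; have py := compress_posE y.
rewrite -compress1_i in px; rewrite -compress1_i in py.
(* A vector common to both fibres makes them coincide, and then only distinct pairs are known to be
   separated. *)
case: (boolP [exists p : 'I_q.+1 * 'I_q.+1, [&& p.1 \in fiber x, p.2 \in fiber y &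
   redistribute x p.1 == redistribute y p.2]]).
  case/existsP=> -[a b] /= /and3P[afx bfy /eqP e].
  have [xa yb] : admissible x a /\ admissible y b.
    by move: afx bfy; rewrite !inE => /andP[-> _] /andP[-> _].
  have ef : fiber x = fiber y.
    by rewrite -(fiber_redistribute xa) e fiber_redistribute.
  have es : x i + x j = y i + y j.
    by rewrite -(redistribute_sum xa) e redistribute_sum.
  have er c : redistribute x c = redistribute y c.
    by rewrite -(redistribute2 _ xa) e redistribute2.
  have npos : compress1 x i != compress1 y i :> nat.
    apply: contra nxy => /eqP/val_inj h.
    by rewrite /compress1 er -compress1_i h compress1_i.
  have sep' a' b' : a' \in fiber x -> b' \in fiber x -> a' != b' ->
     q < a' + b' \/ a' + b' + q < (x i + x j) + (x i + x j).
    move=> h1 h2 h3; rewrite {2}es; apply: sep => //; first by rewrite -ef.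
    by apply: contra h3 => /eqP e3; rewrite -(redistribute_i x a') e3 redistribute_i.
  (* [loop] holds the values whose vector does not meet itself at [i] or [j]; two such vectors would
     not meet each other. Deleting it on one side costs at most 1, regained because [above x] and
     [above y] differ. *)
  set loop := [set c in fiber x | (2 * c <= q) && ((x i + x j) + (x i + x j) <= 2 * c + q)].
  have loop1 : #|loop| <= 1.
    apply/card_le1_eqP => c d; rewrite !in_set => /andP[cf lc] /andP[df ld].
    apply/eqP/contraT => cd; have := sep' d c _ _ cd; rewrite in_set df in_set cf => /(_ isT isT).
    by move: lc ld; clear; lia.
  have cl : #|fiber x :\: loop| + #|loop| = #|fiber x|.
    rewrite addnC -(cardsID loop (fiber x)) (setIidPr _) //.
    by apply/subsetP=> c; rewrite in_set => /andP[].
  have nl : fiber x :\: loop != set0.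
    rewrite -card_gt0; suff : 1 < #|fiber x| by move: cl loop1; clear; lia.
    have xy : x i != y i.
      by apply: contra nxy => /eqP h; rewrite -(redistribute_id x) er h redistribute_id.
    apply/card_gt1P; exists (x i), (y i); split => //; first exact: fiber_id.
    by rewrite ef fiber_id.
  have := @separated_size q (x i + x j) (x i + x j) (fiber x :\: loop) (fiber x) nl fx0.
  move=> sz.
  have {}sz : #|fiber x :\: loop| + #|fiber x| + q <=
       minn q (x i + x j) + minn q (x i + x j) + 1.
    apply: sz; first by rewrite {2}es.
    - by move=> c; rewrite in_setD => /andP[_ /fb].
    - by move=> c /fb.
    move=> c d; rewrite in_setD => /andP[nc cf] df.
    case: (altP (c =P d)) => [<-|cd]; last exact: sep'.
    by move: nc; rewrite in_set cf /=; clear; lia.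
  rewrite -ef in ay; rewrite -es in ly py sy.
  move: sz cl loop1 ax ay lx ly px py npos nmi; clear; lia.
move/existsPn=> ndisj.
have sz : #|fiber x| + #|fiber y| + q <= minn q (x i + x j) + minn q (y i + y j) + 1.
  apply: separated_size => //; [exact: fb|exact: fb|].
  move=> a b ha hb; apply: sep => //; have := ndisj (a, b).
  by rewrite ha hb.
move: sz ax ay lx ly px py nmi; clear; lia.
Qed.

End Compression.

(** * Left-closed families *)

Definition left_closed (q n : nat) (F : {set qvec q n}) : Prop :=
  forall (x : qvec q n) (i j : 'I_n), x \in F -> i < j -> x i < q -> 0 < x j ->
  redistribute i j x (inord (x i).+1) \in F.

(** A potential for termination: moving a unit to a smaller index lowers it. *)
Definition weight (q n : nat) (x : qvec q n) : nat := \sum_(k < n) k * x k.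

Lemma weight_redistribute q n (i j : 'I_n) (x : qvec q n) a :
  i < j -> admissible i j x a ->
  weight (redistribute i j x a) + (j - i) * a = weight x + (j - i) * x i.
Proof.
move=> ij ad; have nij : i != j by apply: contraTneq ij => ->; rewrite ltnn.
rewrite /weight (bigD1 i) //= (bigD1 j) 1?eq_sym //= [in RHS](bigD1 i) //=.
rewrite [in RHS](bigD1 j) 1?eq_sym //= redistribute_i redistribute_j //.
rewrite (eq_bigr (fun k : 'I_n => k * x k)); last first.
  by move=> k /andP[ki kj]; rewrite redistribute_out.
case/andP: ad => h1 h2; move: (\sum_(_ | _) _) => s.
move: (nat_of_ord (x i)) (nat_of_ord (x j)) (nat_of_ord a) h1 h2 => u v w h1 h2.
move: (nat_of_ord i) (nat_of_ord j) ij => i' j' ij.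
have [d ->] : exists d, j' = i' + d by exists (j' - i'); lia.
have -> : i' + d - i' = d by lia.
have [e ev] : exists e, u + v = w + e by exists (u + v - w); lia.
rewrite (_ : u + v - w = e); last by lia.
nia.
Qed.

(** The value [x i + 1] is missing from the fibre, so the values above [x i] do not fill the room up
    to the top. *)
Lemma compress_pos_gt q n (i j : 'I_n) (F : {set qvec q n}) (x : qvec q n) :
  i != j -> x i < q -> 0 < x j ->
  redistribute i j x (inord (x i).+1) \notin F -> x i < compress_pos i j F x.
Proof.
move=> ij xq x0 nF; rewrite compress_posE //.
have : above i j F x <= (minn q (x i + x j)).+1 - (x i).+2.
  apply: card_ord_interval_le => b; rewrite !inE => /andP[/andP[/andP[h1 h2] h4] h3].
  have := ltn_ord b; suff : (b : nat) != (x i).+1 by lia.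
  by apply: contra nF => /eqP <-; rewrite inord_val.
have := above_le ij F x; lia.
Qed.

(** Compress at a pair violating closedness: no weight rises and that of the violating member falls,
    so induction on the total weight applies. *)
Lemma left_closed_exists q n r (F : {set qvec q n}) :
  rank_uniform r F -> sum_intersecting F ->
  exists G : {set qvec q n},
    [/\ #|G| = #|F|, rank_uniform r G, sum_intersecting G & left_closed G].
Proof.
have [N] := ubnP (\sum_(x in F) weight x); elim: N => // N IH in F *.
move=> FN FR FI.
case: (boolP [exists x : qvec q n, exists i : 'I_n, exists j : 'I_n,
  [&& x \in F, i < j, x i < q, 0 < x j &
      redistribute i j x (inord (x i).+1) \notin F]]); last first.
  move=> nex; exists F; split=> // x i j xF ij xi xj.
  apply/contraT=> nF; case/negP: nex; apply/existsP; exists x.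
  by apply/existsP; exists i; apply/existsP; exists j; rewrite xF ij xi xj.
case/existsP=> x /existsP[i] /existsP[j] /and5P[xF ij xi xj nF].
have nij : i != j by apply: contraTneq ij => ->; rewrite ltnn.
have wl (y : qvec q n) : weight (compress1 i j F y) +
    (j - i) * compress_pos i j F y = weight y + (j - i) * y i.
  by apply: weight_redistribute ij _; apply: admissible_compress.
have wle (y : qvec q n) : weight (compress1 i j F y) <= weight y.
  have := compress_pos_ge nij F y; have := wl y; nia.
have wlt : weight (compress1 i j F x) < weight x.
  have := compress_pos_gt nij xi xj nF; have := wl x; nia.
have [|||G [cG GR GI GL]] := IH (compress i j F).
- rewrite /compress big_imset /=; last exact: compress1_inj.
  rewrite -ltnS; apply: leq_trans FN; rewrite ltnS (bigD1 x) //= [X in _ < X](bigD1 x) //=.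
  by rewrite -addSn leq_add // leq_sum.
- move=> _ /compressP[y yF ->]; rewrite rank_redistribute ?FR //.
  exact: admissible_compress.
- exact: compress_intersecting.
by exists G; split=> //; rewrite cG card_compress.
Qed.

(** * Slices by one coordinate *)

Section Slices.

Variables (q n : nat) (k : 'I_n.+1).

Implicit Types (x y : qvec q n) (z : qvec q n.+1) (c d : 'I_q.+1)
  (F : {set qvec q n.+1}).

(** The position [k] is general: the last coordinate serves the induction on [n], the first one the
    counting. *)
Definition insert_coord x c : qvec q n.+1 :=
  [ffun i => if unlift k i is Some j then x j else c].

Lemma insert_coord_at x c : insert_coord x c k = c.
Proof. by rewrite ffunE unlift_none. Qed.

Lemma insert_coord_lift x c j : insert_coord x c (lift k j) = x j.
Proof. by rewrite ffunE liftK. Qed.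

Lemma rank_insert x c : rank (insert_coord x c) = c + rank x.
Proof.
rewrite /rank (bigD1_ord k) //= insert_coord_at; congr (_ + _).
by apply: eq_bigr => j _; rewrite insert_coord_lift.
Qed.

Definition slice F c : {set qvec q n} := [set x | insert_coord x c \in F].

Lemma card_slices F : #|F| = \sum_c #|slice F c|.
Proof.
rewrite -sum1_card (partition_big (fun z : qvec q n.+1 => z k) predT) //=.
apply: eq_bigr => c _; rewrite sum1_card.
have inj : injective (insert_coord^~ c).
  move=> x y /ffunP e; apply/ffunP=> j.
  by have := e (lift k j); rewrite !insert_coord_lift.
rewrite -(card_imset _ inj); apply: eq_card => z; rewrite unfold_in /=.
apply/andP/imsetP=> [[zF /eqP zc]|[x]].
  have e : z = insert_coord [ffun j => z (lift k j)] c.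
    by apply/ffunP=> i; rewrite ffunE; case: unliftP => [j|] -> //; rewrite ffunE.
  by exists [ffun j => z (lift k j)] => //; rewrite inE -e.
by rewrite inE => xF ->; rewrite insert_coord_at eqxx.
Qed.

Lemma rank_slice r F c x :
  rank_uniform r F -> x \in slice F c -> c + rank x = r.
Proof. by move=> FR; rewrite inE => /FR; rewrite rank_insert. Qed.

End Slices.

(** The case x = y is included, so every member has an entry above q/2. *)
Definition strongly_intersecting (q n : nat) (F : {set qvec q n}) : Prop :=
  forall x y : qvec q n, x \in F -> y \in F -> meets x y.

(* When two members meet only in the last coordinate there is room to move a
   unit of one of them to the left without creating a new meeting place. *)
Lemma meets_before_last q n r (F : {set qvec q n.+1}) :
  2 * r <= q * n.+1 -> rank_uniform r F -> strongly_intersecting F ->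
  left_closed F ->
  forall x y : qvec q n.+1, x \in F -> y \in F ->
  exists j : 'I_n, q < x (lift ord_max j) + y (lift ord_max j).
Proof.
move=> rq FR FS FL x y; have [N] := ubnP (x ord_max : nat).
elim: N => // N IH in x *; move=> xN xF yF.
apply/existsP/contraT => /existsPn nm.
have [xyq|xyq] := leqP (x ord_max + y ord_max) q.
  have /existsP[i] := FS _ _ xF yF.
  by case: (unliftP ord_max i) => [j|] -> h; [have := nm j | move: h xyq]; lia.
(* If every earlier coordinate had sum at least q, the two ranks would add up to at least q n + q +
   1, more than 2 r. *)
have [j xyj] : exists j : 'I_n, x (lift ord_max j) + y (lift ord_max j) < q.
  apply/existsP/contraT=> /existsPn h.
  have : \sum_(j < n) q <= \sum_(j < n) (x (lift ord_max j) + y (lift ord_max j)).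
    by apply: leq_sum => j _; have := h j; clear; lia.
  rewrite sum_nat_const card_ord big_split /=.
  have := FR _ xF; have := FR _ yF.
  rewrite /rank !(bigD1_ord ord_max) //=.
  move: (\sum_(_ < n) _) (\sum_(_ < n) _) => u v.
  move: rq xyq; clear; nia.
have lj : lift ord_max j < @ord_max n by rewrite lift_max.
have nlj : lift ord_max j != @ord_max n by rewrite eq_sym neq_lift.
have xj : x (lift ord_max j) < q by move: xyj; clear; lia.
have x0 : 0 < x ord_max by move: xyq (ltn_ord (y ord_max)); clear; lia.
have x'F := FL _ _ _ xF lj xj x0.
have ad : admissible (lift ord_max j) ord_max x (inord (x (lift ord_max j)).+1).
  rewrite /admissible inordK //; move: xj x0 (ltn_ord (x ord_max)); clear; lia.
have [|h] := IH _ _ x'F yF.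
  rewrite redistribute_j // inordK //; move: xN xj x0; clear; lia.
case: (altP (h =P j)) => [->|hj].
  rewrite redistribute_i inordK //; move: xyj; clear; lia.
rewrite redistribute_out; first by move=> H; have := nm h; rewrite H.
  by rewrite (inj_eq lift_inj).
by rewrite eq_sym neq_lift.
Qed.

Lemma slices_meet q n r (F : {set qvec q n.+1}) c d (x y : qvec q n) :
  2 * r <= q * n.+1 -> rank_uniform r F -> strongly_intersecting F ->
  left_closed F ->
  x \in slice ord_max F c -> y \in slice ord_max F d -> meets x y.
Proof.
rewrite !inE => rq FR FS FL xF yF.
have [j] := meets_before_last rq FR FS FL xF yF.
by rewrite !insert_coord_lift => h; apply/existsP; exists j.
Qed.

Lemma left_closed_slice q n (F : {set qvec q n.+1}) c :
  left_closed F -> left_closed (slice ord_max F c).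
Proof.
move=> FL x i j; rewrite !inE => xF ij xi xj.
have := FL _ (lift ord_max i) (lift ord_max j) xF.
rewrite !insert_coord_lift !lift_max => /(_ ij xi xj).
rewrite (_ : redistribute _ _ _ _ =
  insert_coord ord_max (redistribute i j x (inord (x i).+1)) c) //.
apply/ffunP=> k; rewrite [RHS]ffunE.
case: (unliftP ord_max k) => [h|] -> /=; last first.
  by rewrite redistribute_out ?insert_coord_at // neq_lift.
rewrite !ffunE !liftK.
by rewrite !(inj_eq lift_inj).
Qed.

(** * Complements and the lead family *)

Definition compl_vec q n (x : qvec q n) : qvec q n := [ffun i => rev_ord (x i)].

Lemma compl_vecK q n : involutive (@compl_vec q n).
Proof. by move=> x; apply/ffunP=> i; rewrite !ffunE rev_ordK. Qed.

Lemma rank_compl q n (x : qvec q n) : rank (compl_vec x) + rank x = q * n.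
Proof.
rewrite /rank -big_split /= (eq_bigr (fun=> q)).
  by rewrite sum_nat_const card_ord mulnC.
by move=> i _; rewrite ffunE /=; have := ltn_ord (x i); lia.
Qed.

Lemma compl_not_meets q n (x : qvec q n) : ~~ meets (compl_vec x) x.
Proof.
by apply/existsPn=> i; rewrite ffunE /=; have := ltn_ord (x i); lia.
Qed.

Definition lead_large q n (x : qvec q n) : bool :=
  [exists i : 'I_n, (q < 2 * x i) && [forall j : 'I_n, (j < i) ==> (2 * x j == q)]].

Definition lead_family q n r : {set qvec q n} :=
  [set x : qvec q n | lead_large x && (rank x == r)].
Arguments lead_family : clear implicits.

Lemma lead_large_insert q n (x : qvec q n) c :
  lead_large x -> lead_large (insert_coord ord_max x c).
Proof.
case/existsP=> i /andP[xi /forallP h]; apply/existsP; exists (lift ord_max i).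
rewrite insert_coord_lift xi andTb; apply/forallP=> j.
case: (unliftP ord_max j) => [m|] ->; rewrite !lift_max /=.
  by rewrite insert_coord_lift; apply: h.
by apply/implyP; have := ltn_ord i; lia.
Qed.

(** The first entry different from q/2 decides; without one, every entry is q/2 and the rank is q n
    / 2. *)
Lemma lead_large_trichotomy q n (x : qvec q n) :
  [|| lead_large x, lead_large (compl_vec x) | 2 * rank x == q * n].
Proof.
case: (boolP [exists i, 2 * x i != q]); last first.
  move=> /existsPn h; apply/or3P/Or33; apply/eqP.
  have -> : q * n = \sum_(i < n) q by rewrite sum_nat_const card_ord mulnC.
  rewrite /rank big_distrr; apply: eq_bigr => i _.
  by have := h i; rewrite negbK => /eqP.
case/existsP=> i0 h0.
case: (@arg_minnP _ i0 (fun i => 2 * x i != q) val h0) => i hi mn.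
have eqs (j : 'I_n) : j < i -> 2 * x j == q.
  by move=> ji; apply/contraT => /mn /=; lia.
case: (ltngtP (2 * x i) q) hi => // hi _.
  apply/or3P/Or32/existsP; exists i; rewrite ffunE /=.
  apply/andP; split; first by have := ltn_ord (x i); lia.
  apply/forallP=> j; apply/implyP=> /eqs /eqP; rewrite ffunE /=.
  by have := ltn_ord (x j); lia.
apply/or3P/Or31/existsP; exists i; rewrite hi /=.
by apply/forallP=> j; apply/implyP=> /eqs.
Qed.

Lemma rank_uniform_slice q n r (k : 'I_n.+1) (F : {set qvec q n.+1}) (c : 'I_q.+1) :
  rank_uniform r F -> rank_uniform (r - c) (slice k F c).
Proof. by move=> FR x /(rank_slice FR) <-; rewrite addKn. Qed.

(* Complementary slices: y |-> q - y maps the slice at d into the vectors of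
   rank r - c, and a vector never meets its complement. *)
Lemma card_slice_pair_le q n r (F : {set qvec q n.+1}) (c d : 'I_q.+1) :
  2 * r = q * n + c + d -> 2 * r <= q * n.+1 ->
  rank_uniform r F -> strongly_intersecting F -> left_closed F ->
  #|slice ord_max F c| + #|slice ord_max F d| <=
  #|[set x : qvec q n | c + rank x == r]|.
Proof.
move=> e rq FR FS FL.
rewrite -[X in _ + X](card_imset _ (inv_inj (@compl_vecK q n))) -cardsUI.
set D := [set _ | _ in slice _ _ d].
have -> : slice ord_max F c :&: D = set0.
  apply/setP=> x; rewrite in_setI in_set0; apply/negP=> /andP[xF /imsetP[y yF xy]].
  have := slices_meet rq FR FS FL xF yF; rewrite xy.
  exact/negP/compl_not_meets.
rewrite cards0 addn0; apply/subset_leq_card/subsetP=> x.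
case/setUP=> [/(rank_slice FR) <-|/imsetP[y /(rank_slice FR) yr ->]]; rewrite inE //.
have := rank_compl y; move: (rank y) (rank (compl_vec y)) yr => u v; lia.
Qed.

(** Each counted [x] is lead-large and extends by [c], or its complement is and extends by [d]; the
    remaining case, rank q n / 2, would force [c = d]. *)
Lemma card_slice_pair_ge q n r (c d : 'I_q.+1) :
  2 * r = q * n + c + d -> c != d ->
  #|[set x : qvec q n | c + rank x == r]| <=
  #|slice ord_max (lead_family q n.+1 r) c| + #|slice ord_max (lead_family q n.+1 r) d|.
Proof.
move=> e cd.
rewrite -[X in _ + X](card_imset _ (inv_inj (@compl_vecK q n))).
apply: leq_trans (leq_card_setU _ _); apply/subset_leq_card/subsetP=> x.
rewrite inE => /eqP xr; rewrite in_setU.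
case/or3P: (lead_large_trichotomy x) => [xL|xL|/eqP xm].
- by rewrite !inE lead_large_insert // rank_insert xr eqxx.
- apply/orP; right; apply/imsetP; exists (compl_vec x); last by rewrite compl_vecK.
  rewrite !inE lead_large_insert // rank_insert /=.
  have := rank_compl x; move: (rank x) (rank (compl_vec x)) xr => u v; lia.
- by case/negP: cd; rewrite -val_eqE /=; move: (rank x) xr xm => u; lia.
Qed.

(** * The bound for strongly intersecting families *)

(** Summing the inequality over all [c] yields both sides twice, which treats fixed points of [s]
    like all others. *)
Lemma sum_le_involution (T : finType) (s : T -> T) (f g : T -> nat) :
  involutive s -> (forall c, f c + f (s c) <= g c + g (s c)) ->
  \sum_c f c <= \sum_c g c.
Proof.
move=> sK h; have sj := inv_inj sK.
have : \sum_c (f c + f (s c)) <= \sum_c (g c + g (s c)) by apply: leq_sum => c _.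
have e (h' : T -> nat) : \sum_c h' (s c) = \sum_c h' c by rewrite [RHS](reindex_inj sj).
by rewrite !big_split /= !e !addnn leq_double.
Qed.

Lemma strongly_intersecting_bound q n r (F : {set qvec q n}) :
  2 * r <= q * n -> rank_uniform r F -> strongly_intersecting F ->
  left_closed F -> #|F| <= #|lead_family q n r|.
Proof.
elim: n r F => [|n IH] r F rq FR FS FL.
  suff -> : F = set0 by rewrite cards0.
  by apply/setP=> x; rewrite inE; apply/negP=> xF; have /existsP[[]] := FS _ _ xF xF.
rewrite (card_slices ord_max F) (card_slices ord_max (lead_family _ _ _)).
have single (c : 'I_q.+1) : 2 * r <= q * n + 2 * c ->
    #|slice ord_max F c| <= #|slice ord_max (lead_family q n.+1 r) c|.
  move=> rc; have [cr|rc'] := leqP c r; last first.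
    suff -> : slice ord_max F c = set0 by rewrite cards0.
    apply/setP=> x; rewrite in_set0; apply/negP=> /(rank_slice FR).
    by move: (rank x) => u; lia.
  (* Appending an entry keeps a vector lead-large, so the slice at [c] contains the lead family of
     rank r - c. *)
  apply: (@leq_trans #|lead_family q n (r - c)|); last first.
    apply/subset_leq_card/subsetP=> x; rewrite !inE => /andP[xL /eqP xr].
    by rewrite lead_large_insert // rank_insert xr subnKC /=.
  apply: IH; first by lia.
  - exact: rank_uniform_slice.
  - by move=> x y; apply: slices_meet rq FR FS FL.
  - exact: left_closed_slice.
(* The ranks r - c and r - s(c) add up to q n, and s(c) is at most q because 2 r <= q (n + 1). Where
   s(c) would be negative, [c] is fixed and [single] applies. *)
pose s (c : 'I_q.+1) : 'I_q.+1 :=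
  if q * n + c <= 2 * r then inord (2 * r - q * n - c) else c.
have sE (c : 'I_q.+1) : q * n + c <= 2 * r -> s c = 2 * r - q * n - c :> nat.
  by move=> h; rewrite /s h inordK //; lia.
have sI : involutive s.
  move=> c; have [h|h] := leqP (q * n + c) (2 * r); last first.
    by have e : s c = c by [rewrite /s leqNgt h]; rewrite !e.
  by apply/val_inj => /=; rewrite sE ?sE //; lia.
apply: (sum_le_involution sI) => c.
have [h|h] := leqP (q * n + c) (2 * r); last first.
  have -> : s c = c by rewrite /s leqNgt h.
  by apply: leq_add; apply: single; lia.
have sc := sE c h; case: (altP (c =P s c)) => [e|ne].
  by rewrite -e; apply: leq_add; apply: single; rewrite -e in sc; lia.
have e : 2 * r = q * n + c + s c by lia.
exact: leq_trans (card_slice_pair_le e rq FR FS FL) (card_slice_pair_ge e ne).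
Qed.

(** * From sum intersecting to strongly intersecting families *)

Lemma admissible_succ q n (i j : 'I_n) (x : qvec q n) :
  x i < q -> 0 < x j -> admissible i j x (inord (x i).+1).
Proof.
move=> xi xj; rewrite /admissible inordK //.
by move: xi xj (ltn_ord (x j)); clear; lia.
Qed.

Lemma redistribute_succ_i q n (i j : 'I_n) (x : qvec q n) :
  x i < q -> redistribute i j x (inord (x i).+1) i = (x i).+1 :> nat.
Proof. by move=> xi; rewrite redistribute_i inordK. Qed.

Lemma redistribute_succ_j q n (i j : 'I_n) (x : qvec q n) :
  i != j -> x i < q -> 0 < x j ->
  redistribute i j x (inord (x i).+1) j = (x j).-1 :> nat.
Proof.
move=> ij xi xj; rewrite redistribute_j ?admissible_succ // inordK //.
by move: xi xj; clear; lia.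
Qed.

(** Otherwise all entries of [x] are below q/2 while its rank exceeds q/2, so some later entry is
    positive. Moving one unit of it to the first coordinate gives another member that does not meet
    [x]. *)
Lemma odd_meets_self q n r (F : {set qvec q n}) (x : qvec q n) :
  odd q -> 0 < n -> q < 2 * r -> rank_uniform r F -> sum_intersecting F ->
  left_closed F -> x \in F -> meets x x.
Proof.
case: n F x => // n F x oq _ rq FR /sum_intersecting_meets FI FL xF.
apply/contraT => /existsPn nm.
have small i : 2 * x i < q.
  have := nm i; move: oq (nat_of_ord (x i)); clear; lia.
have [j xj] : exists j : 'I_n, 0 < x (lift ord0 j).
  apply/existsP/contraT=> /existsPn h.
  have := FR _ xF; rewrite /rank big_ord_recl big1 => [|j _].
    by have := small ord0; move: rq; clear; lia.
  by have := h j; clear; lia.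
have x0 : x ord0 < q by have := small ord0; clear; lia.
have nj : ord0 != lift ord0 j by rewrite neq_lift.
have yF := FL _ _ _ xF (isT : ord0 < lift ord0 j) x0 xj.
have yi := redistribute_succ_i (lift ord0 j) x0; have yj := redistribute_succ_j nj x0 xj.
have : redistribute ord0 (lift ord0 j) x (inord (x ord0).+1) != x.
  by apply/eqP=> e; move: yi; rewrite e; clear; lia.
move/(FI _ _ yF xF)/existsP=> [k].
case: (altP (k =P ord0)) => [->|k0].
  by rewrite yi; have := small ord0; clear; lia.
case: (altP (k =P lift ord0 j)) => [->|kj].
  by rewrite yj; have := small (lift ord0 j); clear; lia.
by rewrite redistribute_out //; have := small k; clear; lia.
Qed.

Definition self_meeting q n (F : {set qvec q n}) : {set qvec q n} :=
  [set x in F | meets x x].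

(** Two members that do not meet themselves have all entries at most q/2, hence do not meet each
    other; so at most one exists. *)
Lemma card_self_meeting q n (F : {set qvec q n}) :
  sum_intersecting F -> #|F| <= 1 + #|self_meeting F|.
Proof.
move/sum_intersecting_meets => FI; rewrite -(cardsID (self_meeting F) F) addnC.
apply: leq_add; last by apply/subset_leq_card/subsetP=> x /setIP[].
apply/card_le1_eqP => x y; rewrite !in_setD !in_set => /andP[nx xF] /andP[ny yF].
apply/eqP/contraT=> nxy; have /existsP[i] := FI _ _ yF xF nxy.
rewrite xF /= in nx; rewrite yF /= in ny.
by have := existsPn nx i; have := existsPn ny i; clear; lia.
Qed.

Lemma self_meeting_strong q n (F : {set qvec q n}) :
  sum_intersecting F -> strongly_intersecting (self_meeting F).
Proof.
move/sum_intersecting_meets => FI x y; rewrite !in_set => /andP[xF xx] /andP[yF yy].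
by case: (altP (x =P y)) => [<-|nxy] //; apply: FI.
Qed.

(* If x + e_i - e_j does not meet itself, then x + 2 e_i - 2 e_j does not meet x. *)
Lemma self_meeting_left_closed q n (F : {set qvec q n}) :
  sum_intersecting F -> left_closed F -> left_closed (self_meeting F).
Proof.
move/sum_intersecting_meets => FI FL x i j.
rewrite in_set => /andP[xF /existsP[k kq]] ij xi xj.
have nij : i != j by apply: contraTneq ij => ->; rewrite ltnn.
have yF := FL _ _ _ xF ij xi xj; rewrite inE yF /=; apply/contraT => /existsPn nm.
move: yF nm (redistribute_succ_i j xi) (redistribute_succ_j nij xi xj)
  (fun m => @redistribute_out _ _ i j x (inord (x i).+1) m).
move: (redistribute i j x _) => y yF nm yi yj yo.
(* Only the entry at [j] goes down, so at any other place [y] would still meet itself. *)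
have kj : k = j.
  apply/eqP/contraT=> kj; have := nm k; case: (altP (k =P i)) => [ki|ki].
    by rewrite ki yi; move: kq; rewrite ki; clear; lia.
  by rewrite yo // kq.
rewrite {}kj {k} in kq.
have nmi : 2 * (x i).+1 <= q by have := nm i; rewrite yi; clear; lia.
have nmj : 2 * (x j).-1 <= q by have := nm j; rewrite yj; clear; lia.
have yi_lt : y i < q by rewrite yi; move: nmi; clear; lia.
have yj_gt : 0 < y j by rewrite yj; move: nmi kq; clear; lia.
(* [y] is the midpoint of [x] and [z], so z_k + x_k = 2 y_k is at most q at every k. *)
have zF := FL _ _ _ yF ij yi_lt yj_gt.
move: zF (redistribute_succ_i j yi_lt) (redistribute_succ_j nij yi_lt yj_gt)
  (fun m => @redistribute_out _ _ i j y (inord (y i).+1) m).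
move: (redistribute i j y _) => z zF; rewrite yi yj => zi zj zo.
have zx : z != x by apply/eqP=> e; move: zi; rewrite e; clear; lia.
have /existsP[k] := FI _ _ zF xF zx.
case: (altP (k =P i)) => [->|ki]; first by rewrite zi; move: nmi; clear; lia.
case: (altP (k =P j)) => [->|kj]; first by rewrite zj; move: nmi nmj xj; clear; lia.
by rewrite zo //; have := nm k; rewrite yo //; clear; lia.
Qed.

Lemma sum_intersecting_bound_odd q n r (F : {set qvec q n}) :
  odd q -> 0 < n -> q < 2 * r -> 2 * r <= q * n ->
  rank_uniform r F -> sum_intersecting F -> #|F| <= #|lead_family q n r|.
Proof.
move=> oq n0 rlow rup FR FI.
have [G [<- GR GI GL]] := left_closed_exists FR FI.
apply: strongly_intersecting_bound (rup) (GR) _ (GL) => x y xG yG.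
case: (altP (x =P y)) => [<-|nxy]; first exact: (odd_meets_self oq n0 rlow GR GI GL xG).
by apply: (sum_intersecting_meets G).1.
Qed.

Lemma sum_intersecting_bound_even q n r (F : {set qvec q n}) :
  2 * r <= q * n ->
  rank_uniform r F -> sum_intersecting F -> #|F| <= 1 + #|lead_family q n r|.
Proof.
move=> rup FR FI.
have [G [<- GR GI GL]] := left_closed_exists FR FI.
apply: leq_trans (card_self_meeting GI) _; rewrite leq_add2l.
apply: strongly_intersecting_bound rup _ _ _.
- by move=> x; rewrite in_set => /andP[/GR].
- exact: self_meeting_strong.
exact: self_meeting_left_closed.
Qed.

(** * Counting the lead family *)

Lemma lead_large_cons q n (x : qvec q n) c :
  lead_large (insert_coord ord0 x c) = (q < 2 * c) || ((2 * c == q) && lead_large x).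
Proof.
apply/existsP/orP=> [[i]|[qc|/andP[cq /existsP[i /andP[xi /forallP h]]]]].
- case: (unliftP ord0 i) => [j|] ->; last by rewrite insert_coord_at => /andP[]; left.
  rewrite insert_coord_lift => /andP[xj /forallP h]; right.
  have := h ord0; rewrite insert_coord_at /= => ->; apply/existsP; exists j.
  rewrite xj; apply/forallP=> m; have := h (lift ord0 m).
  by rewrite insert_coord_lift.
- exists ord0; rewrite insert_coord_at qc /=; apply/forallP=> j.
  exact: isT.
exists (lift ord0 i); rewrite insert_coord_lift xi; apply/forallP=> j.
case: (unliftP ord0 j) => [m|] ->; last by rewrite insert_coord_at cq implybT.
by rewrite insert_coord_lift; apply: h.
Qed.

(** This counts the vectors of length [n + 1] and rank [l] whose first entry exceeds q/2; [q./2.+1]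
    is the least such entry for either parity. *)
Definition large_head_count q n (l : int) : nat :=
  \sum_(q./2.+1 <= j < q.+1) #|Q q n (l - j%:Z)%R|.

(** A first entry above q/2 leaves the tail free, one equal to q/2 passes the condition to the tail,
    and a smaller one is excluded. The guard [c <= r] keeps [r - c] from truncating. *)
Lemma card_lead_family_slices q n r : #|lead_family q n.+1 r| =
  large_head_count q n r +
  \sum_(c < q.+1 | (2 * c == q) && (c <= r)) #|lead_family q n (r - c)|.
Proof.
rewrite (card_slices ord0) (bigID (fun c : 'I_q.+1 => q < 2 * c)) /=; congr (_ + _).
  rewrite /large_head_count (big_nat_widenl _ 0) // big_mkord.
  apply: eq_big => c; first by clear; lia.
  move=> qc; apply: eq_card => x.
  rewrite !inE lead_large_cons qc rank_insert /=; clear; lia.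
rewrite [LHS](bigID (fun c : 'I_q.+1 => (2 * c == q) && (c <= r))) /=.
rewrite [X in _ + X]big1 ?addn0 => [|c /andP[qc cr]].
  apply: eq_big => c; first by clear; lia.
  case/andP=> qc /andP[cq cr]; apply: eq_card => x.
  rewrite !inE lead_large_cons (negbTE qc) cq rank_insert /=; congr (_ && _).
  by move: cr (rank x); clear; lia.
apply/eqP; rewrite cards_eq0; apply/eqP/setP=> x.
rewrite !inE lead_large_cons (negbTE qc) rank_insert /=.
by apply/negP; move: cr (rank x); case: (lead_large x); clear; lia.
Qed.

(** For odd [q] no entry equals q/2, so only the first sum survives. *)
Lemma card_lead_family_odd q n r : odd q -> 0 < n ->
  #|lead_family q n r| = bound_succq_even n q r.
Proof.
case: n => // n oq _; rewrite card_lead_family_slices big_pred0 ?addn0.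
  by rewrite /large_head_count /bound_succq_even subn1; congr bigop; f_equal; lia.
by move=> c; move: oq; clear; lia.
Qed.

Lemma lead_family_small q n r : 2 * r <= q -> lead_family q n r = set0.
Proof.
move=> rq; suff h (x : qvec q n) : x \notin lead_family q n r.
  by apply/setP=> x; rewrite in_set0 (negbTE (h x)).
rewrite !inE; apply/negP=> /andP[/existsP[i /andP[xi _]] /eqP xr].
have : x i <= rank x by rewrite /rank (bigD1 i) //= leq_addr.
by rewrite xr; move: xi rq; clear; lia.
Qed.

(** Term [i] counts the vectors with i - 1 leading entries [p] followed by a larger one. This
    requires the remaining rank r - (i - 1) p to exceed [p], that is i <= (r - 1) / p. *)
Lemma card_lead_family_double p n r : 0 < p -> r <= p * n ->
  #|lead_family p.*2 n r| =
  \sum_(1 <= i < ((r - 1) %/ p).+1)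
     large_head_count p.*2 (n - i) (r%:Z - ((i - 1) * p)%N%:Z)%R.
Proof.
move=> p0; elim: n r => [|n IH] r rp.
  rewrite lead_family_small ?cards0; last by move: rp; clear; lia.
  by rewrite divn_small ?big_geq //; move: rp p0; clear; lia.
have [rp'|pr] := leqP r p.
  rewrite lead_family_small ?cards0; last by move: rp'; clear; lia.
  by rewrite divn_small ?big_geq //; move: rp' p0; clear; lia.
rewrite card_lead_family_slices.
have pq : p < p.*2.+1 by clear; lia.
rewrite (big_pred1 (Ordinal pq)) /=; last first.
  move=> c; rewrite [RHS]/= -[RHS](inj_eq val_inj) /=; move: pr; clear; lia.
rewrite IH; last by move: rp pr; clear; nia.
have -> : (r - 1) %/ p = ((r - p - 1) %/ p).+1.
  have -> : r - 1 = (r - p - 1) + p by move: pr; clear; lia.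
  by rewrite divnDr // divnn p0 addn1.
rewrite [RHS]big_nat_recl //; congr (_ + _).
  by rewrite subnn mul0n GRing.subr0 subn1.
apply: eq_big_nat => i /andP[i1 _]; congr large_head_count; move: i1 pr; clear; nia.
Qed.

Lemma card_lead_family_even q n r : ~~ odd q -> 0 < q -> 2 * r <= q * n ->
  1 + #|lead_family q n r| = bound_succq_odd n q r.
Proof.
move=> eq q0 rq; have qp : q = (q./2).*2 by move: eq; clear; lia.
move: q./2 qp => p qp; subst q.
rewrite card_lead_family_double; [|by lia|by move: rq; clear; nia].
rewrite /bound_succq_odd /large_head_count exchange_big /=; congr (_ + _).
rewrite -mul2n divnMl //; apply: eq_bigr => j _; apply: eq_bigr => i _.
rewrite (_ : (_ - _ - _)%R = (r%:Z - j%:Z - ((i - 1) * (2 * p) %/ 2)%N%:Z)%R) //.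
by rewrite mulnCA mulKn //; clear; lia.
Qed.

(** * Families attaining the bound *)

(** At the smaller of the two leading positions one entry exceeds q/2 and the other is at least
    q/2. *)
Lemma lead_large_meets q n (x y : qvec q n) :
  lead_large x -> lead_large y -> meets x y.
Proof.
case/existsP=> i /andP[xi /forallP xh] /existsP[j /andP[yj /forallP yh]].
apply/existsP; have := xh j; have := yh i.
have [ij|ji|/val_inj e] := ltngtP i j => /= hy hx.
- by exists i; move: xi hy; clear; lia.
- by exists j; move: yj hx; clear; lia.
by exists j; rewrite e in xi *; move: xi yj; clear; lia.
Qed.

Lemma lead_family_uniform q n r : rank_uniform r (lead_family q n r).
Proof. by move=> x; rewrite in_set => /andP[_ /eqP]. Qed.

Lemma lead_family_intersecting q n r : sum_intersecting (lead_family q n r).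
Proof.
apply/sum_intersecting_meets=> x y; rewrite !in_set => /andP[xL _] /andP[yL _] _.
exact: lead_large_meets.
Qed.

(* The vector (p, ..., p, s, 0, ..., 0) of rank r with 0 <= s < p. *)
Definition staircase p n r : qvec p.*2 n :=
  [ffun i : 'I_n => inord (minn p (r - i * p))].
Arguments staircase : clear implicits.

Lemma staircaseE p n r i : staircase p n r i = minn p (r - i * p) :> nat.
Proof. by rewrite ffunE inordK //; clear; lia. Qed.

Lemma rank_staircase p n r : r <= p * n -> rank (staircase p n r) = r.
Proof.
move=> rp; rewrite /rank (eq_bigr (fun i : 'I_n => minn p (r - i * p))).
  suff h m : \sum_(i < m) minn p (r - i * p) = minn r (m * p).
    by rewrite h; move: rp; clear; lia.
  elim: m => [|m IH]; first by rewrite big_ord0; clear; lia.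
  by rewrite big_ord_recr /= IH mulSn; move: (m * p) => k; clear; lia.
by move=> i _; rewrite staircaseE.
Qed.

Lemma staircase_not_lead p n r : staircase p n r \notin lead_family p.*2 n r.
Proof.
rewrite inE; apply/negP=> /andP[/existsP[i /andP[]]].
by rewrite staircaseE; clear; lia.
Qed.

(* If the entry at the leading position i of x were below p, the staircase
   would lie below x coordinatewise, strictly at i, although the ranks agree. *)
Lemma staircase_meets p n r (x : qvec p.*2 n) :
  r <= p * n -> x \in lead_family p.*2 n r -> meets (staircase p n r) x.
Proof.
move=> rp; rewrite inE => /andP[/existsP[i /andP[xi /forallP h]] /eqP xr].
apply/existsP; exists i; rewrite staircaseE.
have [pr|rip] := leqP p (r - i * p); first by move: xi; clear; lia.
suff : rank (staircase p n r) < rank x by rewrite rank_staircase // xr ltnn.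
rewrite /rank (bigD1 i) //= [X in _ < X](bigD1 i) //= -addSn; apply: leq_add.
  by rewrite staircaseE; move: xi; clear; lia.
apply: leq_sum => j ji; rewrite staircaseE.
have [lt|gt|/val_inj e] := ltngtP j i.
- by have := h j; rewrite lt /=; clear; lia.
(* Since r - i p < p, the staircase vanishes after position [i]. *)
- by rewrite (_ : r - j * p = 0); move: rip gt; clear; nia.
by rewrite e eqxx in ji.
Qed.

Theorem theorem1p4 (n q r : nat) (hn : 1 <= n) (hq : 1 <= q) (hr : 1 <= r)
    (hlow : q.+1 <= 2 * r) (hup : 2 * r <= q * n) :
  (forall F : {set qvec q n},
      rank_uniform r F -> sum_intersecting F -> #|F| <= bound n q r)
  /\
  (exists F : {set qvec q n},
      [/\ rank_uniform r F, sum_intersecting F & #|F| = bound n q r]).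
Proof.
rewrite /bound /=; case: (boolP (odd q)) => oq /=.
  rewrite -card_lead_family_odd //; split=> [F FR FI|].
    exact: sum_intersecting_bound_odd.
  exists (lead_family q n r); split=> //; first exact: lead_family_uniform.
  exact: lead_family_intersecting.
rewrite -card_lead_family_even //; split=> [F FR FI|].
  exact: sum_intersecting_bound_even.
have qp : q = (q./2).*2 by move: oq; clear; lia.
move: q./2 qp => p qp; subst q.
have rp : r <= p * n by move: hup; clear; nia.
(* The staircase has all entries at most q/2 and is the one member that does not meet itself; it
   accounts for the summand 1. *)
exists (staircase p n r |: lead_family p.*2 n r).
split; last by rewrite cardsU1 staircase_not_lead.
  move=> x /setU1P[->|]; [exact: rank_staircase | exact: lead_family_uniform].
apply/sum_intersecting_meets=> x y /setU1P[->|xL] /setU1P[->|yL].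
- by rewrite eqxx.
- by move=> _; apply: staircase_meets.
- by move=> _; rewrite meetsC; apply: staircase_meets.
by apply: (sum_intersecting_meets _).1 xL yL; apply: lead_family_intersecting.
Qed.
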